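(* Let $\boldsymbol\lambda=(\lambda^0\mid\cdots\mid\lambda^{r-1})$ be an $r$-partite partition of size $n$ and write $\lambda^t=\langle1^{m_{t,1}},2^{m_{t,2}},\dots,n^{m_{t,n}}\rangle$ in frequency notation. Then the number of square roots in $G(r,1,n)$ (elements $\pi$ with $\pi^2=g$) of an element $g$ of cycle type $\boldsymbol\lambda$ is the coefficient of $(x_{0,1}^{m_{0,1}}\cdots x_{0,n}^{m_{0,n}})\cdots(x_{r-1,1}^{m_{r-1,1}}\cdots x_{r-1,n}^{m_{r-1,n}})$ in \[\begin{cases}\displaystyle\prod_{k\ge1}\prod_{t=0}^{r-1}\Big(\mathcal{D}(2kr\,x_{t,2k}^2)\,\mathcal{R}_{r(2k-1)}(x_{t,2k-1})\Big) & r\text{ odd},\\[0.3cm] \displaystyle\prod_{k\ge1}\Big(\prod_{t=0}^{r-1}\mathcal{D}(2kr\,x_{t,2k}^2)\prod_{\substack{0\le t\le r-1\\ t\text{ odd}}}\mathcal{D}((2k-1)r\,x_{t,2k-1}^2)\prod_{\substack{0\le t\le r-1\\ t\text{ even}}}\mathcal{R}_{\frac{r(2k-1)}{4}}(2x_{t,2k-1})\Big) & r\text{ even}.\end{cases}\] Therefore the generating function in $n$ of the sum, over all conjugacy classes of $G(r,1,n)$, of the number of square roots of a representative of the class is \[\begin{cases}\displaystyle\prod_{k\ge1}\Big(\mathcal{D}(2kr\,x^{4k})^r\,\mathcal{R}_{r(2k-1)}(x^{2k-1})^r\Big) & r\text{ odd},\\[0.3cm] \displaystyle\prod_{k\ge1}\Big(\mathcal{D}(2kr\,x^{4k})^r\,\mathcal{D}((2k-1)r\,x^{4k-2})^{r/2}\,\mathcal{R}_{\frac{r(2k-1)}{4}}(2x^{2k-1})^{r/2}\Big)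 & r\text{ even}.\end{cases}\]
   Context: Let $\mathbb{Z}_r$ be the cyclic group of order $r$. $G(r,1,n)=\{(z_1,\dots,z_n;\sigma):z_i\in\mathbb{Z}_r,\sigma\in S_n\}$ with product $(z;\sigma)(z';\sigma')=(z_1+z'_{\sigma^{-1}(1)},\dots,z_n+z'_{\sigma^{-1}(n)};\sigma\sigma')$. The color of a cycle $(u_1,\dots,u_\ell)$ of $\sigma$ is $z_{u_1}+\cdots+z_{u_\ell}$; the cycle type of $(z;\sigma)$ is $(\lambda^0\mid\cdots\mid\lambda^{r-1})$ with $\lambda^j$ the partition of lengths of color-$j$ cycles; conjugacy classes are exactly the sets of elements with a given cycle type. In frequency notation, $m_{t,j}$ is the number of parts of $\lambda^t$ equal to $j$. $x$ and $x_{t,j}$ are commuting indeterminates. $(2k-1)!!=(2k-1)(2k-3)\cdots1$, $(-1)!!=1$; $\mathcal{D}(x)=\sum_{n\ge0}(2n-1)!!x^n$; for a parameter $c$, $\mathcal{R}_c(x)=\sum_{n\ge0}o_c(n)x^n$ with $o_c(n)=\sum_{k=0}^{\lfloor n/2\rfloor}\binom{n}{2k}(2k-1)!!\,c^k$. *)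

(* Defs.v *)
From HB Require Import structures.
From mathcomp Require Import all_boot all_order all_algebra all_fingroup.
From mathcomp Require Import mpoly.
Set Implicit Arguments. Unset Strict Implicit. Unset Printing Implicit Defensive.
Import Order.TTheory GRing.Theory Num.Theory.
Local Open Scope ring_scope.

(* Z_r, for r >= 1, represented as 'I_r (= 'I_(r.-1).+1), with its additive group
   structure (addition mod r). *)
Definition col (r : nat) := 'I_(r.-1).+1.

Definition Grn (r n : nat) := ({ffun 'I_n -> col r} * {perm 'I_n})%type.

(* (z;s)(z';s') = (z_i + z'_{s^{-1}(i)} ; s s'), where s s' is the composite
   "first s', then s", i.e. (s' * s)%g in MathComp's left-to-right convention. *)
Definition gmul (r n : nat) (a b : Grn r n) : Grn r n :=
  ([ffun i => a.1 i + b.1 ((a.2)^-1%g i)], (b.2 * a.2)%g).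

Definition ginv (r n : nat) (a : Grn r n) : Grn r n :=
  ([ffun i => - a.1 (a.2 i)], (a.2)^-1%g).

Definition gone (r n : nat) : Grn r n := ([ffun => 0], 1%g).

Definition nsqrt (r n : nat) (g : Grn r n) : nat :=
  #|[set p : Grn r n | gmul p p == g]|.

Definition conj_class (r n : nat) (g : Grn r n) : {set Grn r n} :=
  [set gmul (gmul p g) (ginv p) | p : Grn r n].
Definition gclasses (r n : nat) : {set {set Grn r n}} :=
  [set conj_class g | g : Grn r n].
Definition crepr (r n : nat) (C : {set Grn r n}) : Grn r n :=
  odflt (gone r n) [pick x in C].

Definition cycle_color (r n : nat) (z : {ffun 'I_n -> col r}) (C : {set 'I_n}) : col r :=
  \sum_(u in C) z u.

Definition mult (r n : nat) (g : Grn r n) (t j : nat) : nat :=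
  #|[set C in porbits g.2 | (#|C| == j) && (val (cycle_color g.1 C) == t)]|.

(* double factorial; dfact (2k-1) = (2k-1)!!, with (-1)!! = dfact 0 = 1 *)
Fixpoint dfact (m : nat) : nat :=
  match m with 0 => 1 | 1 => 1 | m'.+2 => m'.+2 * dfact m' end.

Definition Dser (i : nat) : rat := (dfact (2 * i - 1))%:R.
Definition Rser (c : rat) (i : nat) : rat :=
  \sum_(k < (i./2).+1) ('C(i, 2 * k))%:R * (dfact (2 * k - 1))%:R * c ^+ k.

(* Truncation of the substituted series  a(y) = sum_i a_i y^i  to i <= N
   (y without constant term, in an algebra over rat). *)
Definition trunc_eval (A : lalgType rat) (a : nat -> rat) (N : nat) (y : A) : A :=
  \sum_(i < N.+1) a i *: y ^+ i.

(* Variables x_{t,j}, 0 <= t < r, 0 <= j <= 2n, encoded as the index t*(2n+1)+j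
   of {mpoly rat[r * (2n+1)]}. *)
Definition NV (n : nat) := (2 * n).+1.
(* number of variables; one extra (unused) index is added so that the
   variable count is syntactically a successor. *)
Definition NX (r n : nat) := (r * NV n).+1.
Definition xv (r n t j : nat) : {mpoly rat[NX r n]} := 'X_(inord (t * NV n + j)).

Definition ctype_monom (r n : nat) (g : Grn r n) : 'X_{1..NX r n} :=
  [multinom mult g (i %/ NV n) (i %% NV n) | i < NX r n].

(* The product of Theorem 6.6, truncated: factors k > n and per-variable
   degrees > n cannot contribute to the coefficient of monomials whose
   variables have index <= n and degree <= n. *)
Definition sqrt_gf_multi (r n : nat) : {mpoly rat[NX r n]} :=
  if odd r then
    \prod_(1 <= k < n.+1) \prod_(t < r)
      (trunc_eval Dser n ((2 * k * r)%:R *: xv r n t (2 * k) ^+ 2) *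
       trunc_eval (Rser (r * (2 * k - 1))%:R) n (xv r n t (2 * k - 1)))
  else
    \prod_(1 <= k < n.+1)
      ((\prod_(t < r) trunc_eval Dser n ((2 * k * r)%:R *: xv r n t (2 * k) ^+ 2)) *
       (\prod_(t < r | odd t)
          trunc_eval Dser n (((2 * k - 1) * r)%:R *: xv r n t (2 * k - 1) ^+ 2)) *
       (\prod_(t < r | ~~ odd t)
          trunc_eval (Rser ((r * (2 * k - 1))%:R / 4%:R)) n
                     (2%:R *: xv r n t (2 * k - 1)))).

Definition sqrt_gf_uni (r n : nat) : {poly rat} :=
  if odd r then
    \prod_(1 <= k < n.+1)
      (trunc_eval Dser n ((2 * k * r)%:R *: 'X^(4 * k)) ^+ r *
       trunc_eval (Rser (r * (2 * k - 1))%:R) n 'X^(2 * k - 1) ^+ r)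
  else
    \prod_(1 <= k < n.+1)
      (trunc_eval Dser n ((2 * k * r)%:R *: 'X^(4 * k)) ^+ r *
       trunc_eval Dser n (((2 * k - 1) * r)%:R *: 'X^(4 * k - 2)) ^+ r./2 *
       trunc_eval (Rser ((r * (2 * k - 1))%:R / 4%:R)) n (2%:R *: 'X^(2 * k - 1)) ^+ r./2).

(* Main.v *)
Require Import Defs.
From HB Require Import structures.
From mathcomp Require Import all_boot all_order all_algebra all_fingroup.
From mathcomp Require Import cyclic mpoly zify ring.
Set Implicit Arguments. Unset Strict Implicit. Unset Printing Implicit Defensive.
Import GRing.Theory.
Local Open Scope ring_scope.

(** An element [g] of [G(r,1,n)] acts on [X = 'I_n * Z_r] by a permutation commuting
    with the shifts of the second component, so [X] is a set with an action of a finite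
    abelian group [K] generated by [g] and the shifts. The orbits of [K] are the cycles
    of [g], two orbits are isomorphic iff the cycles have the same length and colour,
    and the square roots of [g] are the [K]-equivariant maps [f] with [f \o f = g].
    Such an [f] is determined on the orbit of [x] and on its image by [f x]: either [f]
    preserves the orbit of [x] ([s] choices of [f x], depending on the type only), or it
    exchanges it with one of the [m - 1] other isomorphic orbits ([r j] choices each).
    This gives the recurrence [a (m + 1) = s a m + m r j a (m - 1)] in each type
    separately, which the coefficients of the series D and R satisfy.

    Equivariant maps also show that elements with the same cycle type are conjugate.
    Hence conjugacy classes correspond to the monomials of weight [n], and the
    univariate series is obtained from the multivariate one by [x_{t,j} := X^j]. *)

(** * Equivariant square roots for an abelian group action *)

Section Action.
Variables (K : finZmodType).

Definition is_act (X : finType) (act : K -> X -> X) :=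
  (forall x, act 0 x = x) /\ (forall a b x, act (a + b) x = act a (act b x)).

Section OneAction.
Variables (X : finType) (act : K -> X -> X).
Hypothesis actP : is_act act.

Lemma act0 x : act 0 x = x. Proof. exact: actP.1. Qed.
Lemma actD a b x : act (a + b) x = act a (act b x). Proof. exact: actP.2. Qed.
Lemma actC a b x : act a (act b x) = act b (act a x).
Proof. by rewrite -!actD addrC. Qed.
Lemma actK a x : act (- a) (act a x) = x.
Proof. by rewrite -actD addNr act0. Qed.
Lemma act_inj a : injective (act a).
Proof. exact: can_inj (actK a). Qed.

Definition orb x : {set X} := [set act k x | k : K].

Lemma orbP x y : reflect (exists k, y = act k x) (y \in orb x).
Proof.
by apply: (iffP imsetP) => [[k _ ->]|[k ->]]; exists k.
Qed.
Lemma mem_orb k x : act k x \in orb x.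
Proof. by apply/orbP; exists k. Qed.
Lemma orb_refl x : x \in orb x.
Proof. by rewrite -{1}(act0 x) mem_orb. Qed.

Definition stable (A : {set X}) := forall k x, x \in A -> act k x \in A.

Lemma stableE A k x : stable A -> (act k x \in A) = (x \in A).
Proof.
move=> sA; apply/idP/idP => [|]; last exact: sA.
by move/(sA (- k)); rewrite actK.
Qed.
Lemma stable_orb x : stable (orb x).
Proof. by move=> k _ /orbP[k' ->]; rewrite -actD mem_orb. Qed.
Lemma stableU A B : stable A -> stable B -> stable (A :|: B).
Proof.
by move=> sA sB k x; rewrite !inE => /orP[/sA->|/sB->]; rewrite ?orbT.
Qed.
Lemma stableD A B : stable A -> stable B -> stable (A :\: B).
Proof. by move=> sA sB k x; rewrite !inE !stableE. Qed.
Lemma orb_sub A x : stable A -> x \in A -> orb x \subset A.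
Proof. by move=> sA xA; apply/subsetP => _ /orbP[k ->]; apply: sA. Qed.

Lemma eq_orb x y : y \in orb x -> orb y = orb x.
Proof.
case/orbP => k ->; apply/eqP; rewrite eqEsubset !orb_sub ?mem_orb //.
- exact: stable_orb.
- by apply/orbP; exists (- k); rewrite actK.
- exact: stable_orb.
Qed.

(** A type is constant on orbits, so removing the orbit of [x] lowers one count by the whole orbit
    and leaves the others alone. Both inductions that remove orbits rest on this. *)
Lemma card_type_setD_orb (I : eqType) (ty : X -> I) (A : {set X}) x i :
  (forall k u, ty (act k u) = ty u) -> orb x \subset A ->
  #|[set u in A :\: orb x | ty u == i]| =
  (#|[set u in A | ty u == i]| - (ty x == i) * #|orb x|)%N.
Proof.
move=> tyA sub.
have -> : [set u in A :\: orb x | ty u == i] = [set u in A | ty u == i] :\: orb x.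
  by apply/setP => u; rewrite !inE andbA.
rewrite cardsD; congr (_ - _)%N; case: eqP => [<-|ne].
  rewrite mul1n (setIidPr _) //; apply/subsetP => u ux.
  by rewrite inE (subsetP sub) //=; case/orbP: ux => k ->; rewrite tyA.
rewrite mul0n; apply/eqP; rewrite cards_eq0; apply/eqP/setP => u.
rewrite !inE; apply/negP => /andP[/andP[_ /eqP e] /orbP[k eu]].
by apply: ne; rewrite -e eu tyA.
Qed.

End OneAction.

(** * Stabilisers and equivariant maps between orbits *)

Definition same_stab (X Y : finType) (act : K -> X -> X) (act' : K -> Y -> Y)
    (x : X) (y : Y) :=
  [forall k, (act k x == x) == (act' k y == y)].

Lemma same_stabP (X Y : finType) (act : K -> X -> X) (act' : K -> Y -> Y) x y :
  reflect (forall k, act k x = x <-> act' k y = y) (same_stab act act' x y).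
Proof.
apply: (iffP forallP) => h k.
  by split => /eqP; [rewrite (eqP (h k))|rewrite -(eqP (h k))] => /eqP.
by apply/eqP; apply/eqP/eqP; case: (h k).
Qed.

(* The equivariant map [act k x |-> act' k y]; junk off [orb act x]. *)
Definition ext (X Y : finType) (act : K -> X -> X) (act' : K -> Y -> Y) x y u :=
  act' (odflt 0 [pick k | act k x == u]) y.

Lemma extE (X Y : finType) (act : K -> X -> X) (act' : K -> Y -> Y) x y k :
  is_act act -> is_act act' -> same_stab act act' x y ->
  ext act act' x y (act k x) = act' k y.
Proof.
move=> aP aP' /same_stabP h; rewrite /ext; case: pickP => [k' /eqP e|/(_ k)] /=;
  last by rewrite eqxx.
(* Two elements [k], [k'] reaching the same point differ by a stabiliser element of [x], which also
   fixes [y]. *)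
apply: (act_inj aP' (a := - k)); rewrite (actK aP') -(actD aP').
by apply/h; rewrite (actD aP) e (actK aP).
Qed.

Lemma card_orb_same_stab (X Y : finType) (act : K -> X -> X) (act' : K -> Y -> Y) x y :
  is_act act -> is_act act' -> same_stab act act' x y ->
  #|orb act x| = #|orb act' y|.
Proof.
move=> aP aP' h.
have -> : orb act' y = [set ext act act' x y u | u in orb act x].
  apply/setP => v; apply/orbP/imsetP => [[k ->]|[_ /orbP[k ->] ->]].
    by exists (act k x); rewrite ?mem_orb ?extE.
  by exists k; rewrite extE.
rewrite card_in_imset // => _ _ /orbP[k ->] /orbP[l ->]; rewrite !extE // => e.
have /same_stabP/(_ (- l + k)) := h; rewrite (actD aP) (actD aP') e (actK aP').
by case=> _ /(_ erefl) e'; apply: (act_inj aP (a := - l)); rewrite e' (actK aP).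
Qed.

(* An equivariant map is determined on an orbit by one value, which may be any
   point with the same stabiliser. *)
Lemma equivariant_bijection_exists (I : eqType) (X : finType)
    (act act' : K -> X -> X) (ty ty' : X -> I) :
  is_act act -> is_act act' ->
  (forall k x, ty (act k x) = ty x) -> (forall k y, ty' (act' k y) = ty' y) ->
  (forall x y, ty x = ty' y -> same_stab act act' x y) ->
  forall A B : {set X}, stable act A -> stable act' B ->
  (forall i, #|[set x in A | ty x == i]| = #|[set y in B | ty' y == i]|) ->
  exists f : X -> X, [/\ {in A, forall x, f x \in B}, {in A &, injective f}
    & {in A, forall x k, f (act k x) = act' k (f x)}].
Proof.
move=> aP aP' tyA tyA' tyS A; have [n] := ubnP #|A|.
elim: n A => // n IH A ltA B sA sB eqc.
have [A0|[x xA]] := set_0Vmem A.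
  by exists id; rewrite A0; split => x; rewrite inE.
have [y yB tyy] : exists2 y, y \in B & ty' y = ty x.
  have : (0 < #|[set y in B | ty' y == ty x]|)%N.
    by rewrite -eqc; apply/card_gt0P; exists x; rewrite inE xA /=.
  by case/card_gt0P => y; rewrite inE => /andP[yB /eqP]; exists y.
have xy : same_stab act act' x y by apply: tyS.
have subA := orb_sub sA xA; have subB := orb_sub sB yB.
have [||||f [fB fi fk]] := IH (A :\: orb act x) _ (B :\: orb act' y).
- rewrite cardsD (setIidPr subA) -ltnS; apply: leq_trans ltA.
  rewrite ltnS ltn_subrL andbC; apply/andP; split.
    by apply/card_gt0P; exists x.
  by apply/card_gt0P; exists x; apply: orb_refl.
- exact/stableD/stable_orb.
- exact/stableD/stable_orb.
- by move=> i; rewrite !card_type_setD_orb // tyy (card_orb_same_stab aP aP' xy) eqc.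
have extB u : u \in orb act x -> ext act act' x y u \in orb act' y.
  by case/orbP => k ->; rewrite extE // mem_orb.
exists (fun u => if u \in orb act x then ext act act' x y u else f u); split.
- move=> u uA; case: ifP => uO; first exact/(subsetP subB)/extB.
  by have := fB u; rewrite !inE uO uA => /(_ isT)/andP[].
- move=> u v uA vA; have fN w : w \in A -> w \notin orb act x -> f w \notin orb act' y.
    by move=> wA wO; have := fB w; rewrite !inE wO wA => /(_ isT)/andP[].
  case: ifPn => uO; case: ifPn => vO e.
  + case/orbP: uO vO e => k -> /orbP[l ->]; rewrite !extE // => e.
    apply: (act_inj aP (a := - l)); rewrite (actK aP) -(actD aP).
    by have /same_stabP sxy := xy; apply/sxy; rewrite (actD aP') e (actK aP').
  + by have := fN v vA vO; rewrite -e extB.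
  + by have := fN u uA uO; rewrite e extB.
  + by apply: fi => //; rewrite inE ?uO ?vO.
- move=> u uA k; rewrite (stableE aP _ _ (stable_orb aP (x := x))); case: ifPn => uO.
    by case/orbP: uO => l ->; rewrite -(actD aP) !extE // (actD aP').
  by apply: fk; rewrite inE uO.
Qed.

(* Sum over the involutions of [m] points of [s] to the number of fixed points times
   [c] to the number of transposed pairs. *)
Fixpoint matching_poly (s c m : nat) : nat :=
  if m is m'.+1 then
    (s * matching_poly s c m' +
     if m' is m''.+1 then m' * c * matching_poly s c m'' else 0)%N
  else 1%N.

Lemma matching_polyS s c m : matching_poly s c m.+1 =
  (s * matching_poly s c m + c * m * matching_poly s c m.-1)%N.
Proof. by case: m => [|m] /=; rewrite ?muln0 // (mulnC c). Qed.

(** * Counting equivariant roots orbit by orbit *)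

Section Roots.
Variables (X : finType) (act : K -> X -> X) (kap : K).
Hypothesis actP : is_act act.
Let actD := actD actP.
Let actC := actC actP.
Let actK := actK actP.

(** Fixing every point off [A] makes a root on [A] a single finite function, so that roots on
    subsets can be counted and glued. *)
Definition eqroots (A : {set X}) : {set {ffun X -> X}} :=
  [set f : {ffun X -> X} | [forall x, if x \in A
    then [&& f x \in A, f (f x) == act kap x & [forall k, f (act k x) == act k (f x)]]
    else f x == x]].

Lemma eqrootsP (A : {set X}) (f : {ffun X -> X}) : reflect
  [/\ {in A, forall x, f x \in A}, {in A, forall x, f (f x) = act kap x},
      {in A, forall x k, f (act k x) = act k (f x)} &
      forall x, x \notin A -> f x = x] (f \in eqroots A).
Proof.
rewrite inE; apply: (iffP forallP) => [h|[h1 h2 h3 h4] x].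
  split=> x xA; have := h x; rewrite ?xA ?(negPf xA).
  - by case/and3P.
  - by case/and3P => _ /eqP.
  - by case/and3P => _ _ /forallP hk k; apply/eqP.
  - by move/eqP.
case: ifPn => xA; last by rewrite h4.
by rewrite h1 // h2 // eqxx; apply/forallP => k; rewrite h3.
Qed.

Lemma eqroots0 : #|eqroots set0| = 1%N.
Proof.
apply/eqP/cards1P; exists [ffun x => x]; apply/setP => f; rewrite in_set1.
apply/eqrootsP/eqP => [[_ _ _ h]|->].
  by apply/ffunP => x; rewrite ffunE h // inE.
by split => x; rewrite ?inE // ffunE.
Qed.

(** If [f x = act k x], then [f] is [act k] on the whole orbit, as [K] is abelian; hence
    [f (f x) = act k y], which has to be [act kap x]. *)
Definition local_root x y := [exists k, (act k x == y) && (act k y == act kap x)].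

(** The possible values of a root at [x]: [root_valueP] gives necessity, [root_glue_exists]
    sufficiency. *)
Definition root_value x y :=
  same_stab act act x y && ((y \in orb act x) ==> local_root x y).

Lemma root_valueP A f x : f \in eqroots A -> x \in A -> root_value x (f x).
Proof.
case/eqrootsP => h1 h2 h3 h4 xA; apply/andP; split.
  apply/same_stabP => k; split => e; first by rewrite -h3 // e.
  (* If [k] fixes [f x], then it fixes [f (f x) = act kap x], hence also [x]. *)
  apply: (act_inj actP (a := kap)); rewrite actC -h2 // -h3 ?h1 //.
  by rewrite e.
apply/implyP => /orbP[k e]; apply/existsP; exists k.
by rewrite -e eqxx /= -h2 // -h3 // -e.
Qed.

Lemma same_stab_act x y k :
  same_stab act act x y -> same_stab act act y (act k x).
Proof.
move=> /same_stabP h; apply/same_stabP => l; rewrite actC.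
by split => [/h->|/(act_inj actP)/h].
Qed.

(** The root is forced: it sends [act k x] to [act k y] and [act k y] to [act k (act kap x)]. *)
Lemma root_glue_exists x y : root_value x y ->
  exists2 f, f \in eqroots (orb act x :|: orb act y) & f x = y.
Proof.
case/andP => xy /implyP loc; have yx := same_stab_act kap xy.
set B := _ :|: _.
have sB : stable act B by apply: stableU => //; apply: stable_orb.
pose h u := if u \in orb act x then ext act act x y u
            else if u \in orb act y then ext act act y (act kap x) u else u.
have hx k : h (act k x) = act k y by rewrite /h mem_orb extE.
have hy k : h (act k y) = act k (act kap x).
  rewrite /h (stableE actP _ _ (stable_orb actP (x := x))); case: ifPn => [yO|yO].
    (* When the orbits coincide only the first branch of [h] is reached; [local_root] makes it agree
       with the value prescribed at [act k y]. *)
    have /existsP[l /andP[/eqP e /eqP e']] := loc yO.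
    by rewrite -{2}e -actD extE // actD e'.
  by rewrite mem_orb extE.
have Bx k : act k x \in B by rewrite inE mem_orb.
have By k : act k y \in B by rewrite inE mem_orb orbT.
exists [ffun u => h u]; last by rewrite ffunE -{1}(act0 actP x) hx (act0 actP).
apply/eqrootsP; split => u.
- by rewrite !inE !ffunE => /orP[] /orbP[k ->]; rewrite ?hx ?hy -?actD;
    rewrite -in_setU.
- by rewrite !inE !ffunE => /orP[] /orbP[k ->]; rewrite ?hx ?hy -?actD ?hx ?hy
    -?actD // addrC.
- by rewrite !inE => /orP[] /orbP[k ->] l; rewrite !ffunE -actD ?hx ?hy -?actD ?addrA.
- by rewrite !inE negb_or ffunE /h => /andP[/negPf-> /negPf->].
Qed.

(** The value [y] at [x] forces [f] on both orbits, so [f] is the glued root [f0] there and an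
    arbitrary root on the remaining points. *)
Lemma card_eqroots_value A x y : stable act A -> x \in A -> y \in A ->
  root_value x y ->
  #|[set f in eqroots A | f x == y]| =
  #|eqroots (A :\: (orb act x :|: orb act y))|.
Proof.
move=> sA xA yA /root_glue_exists[f0 f0B f0x]; set B := _ :|: _ in f0B *.
have sB : stable act B by apply: stableU => //; apply: stable_orb.
have subA : B \subset A by rewrite subUset !orb_sub.
have xB : x \in B by rewrite inE orb_refl.
have yB : y \in B by rewrite inE orb_refl // orbT.
case/eqrootsP: (f0B) => f1 f2 f3 f4.
pose gl (h : {ffun X -> X}) := [ffun u => if u \in B then f0 u else h u].
rewrite -[RHS](card_in_imset (f := gl)); last first.
  move=> h h' /eqrootsP[_ _ _ h4] /eqrootsP[_ _ _ h4'] /ffunP e; apply/ffunP => u.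
  have := e u; rewrite !ffunE; case: ifP => // uB _.
  by rewrite h4 ?h4' // inE uB.
apply: eq_card => f; rewrite in_set.
apply/andP/imsetP => [[/eqrootsP[h1 h2 h3 h4] /eqP fx]|[h hR ->]].
  have fB u : u \in B -> f u = f0 u.
    have fy : f y = f0 y by rewrite -{1}fx h2 // -f0x f2.
    by rewrite inE => /orP[] /orbP[k ->]; rewrite h3 // f3 // ?fx ?f0x ?fy.
  exists [ffun u => if u \in B then u else f u].
    (* The complement of [B] is preserved: if [f u] were in [B], so would be [f (f u) = act kap u],
       and hence [u]. *)
    have fD u : u \in A :\: B -> f u \in A :\: B.
      rewrite !inE => /andP[uB uA]; rewrite h1 // andbT -in_setU -/B.
      rewrite -in_setU -/B in uB; apply: contra uB => fuB.
      by have := f1 _ fuB; rewrite -fB // h2 // stableE.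
    have fE u : u \in A :\: B -> [ffun u => if u \in B then u else f u] u = f u.
      by rewrite inE ffunE => /andP[/negPf->].
    have sD : stable act (A :\: B) by apply: stableD.
    apply/eqrootsP; split => u uD.
    - by rewrite fE // fD.
    - by rewrite !fE ?fD // h2 //; case/setDP: uD.
    - by move=> k; rewrite !fE ?sD // h3 //; case/setDP: uD.
    - by rewrite ffunE; case: ifPn => // uB; rewrite h4 //; apply: contra uD => uA; rewrite inE uB.
  by apply/ffunP => u; rewrite !ffunE; case: (boolP (u \in B)) => [/fB|].
case/eqrootsP: hR => h1 h2 h3 h4; rewrite ffunE xB f0x eqxx; split=> //.
apply/eqrootsP; split => u uA; rewrite !ffunE; case: (boolP (u \in B)) => uB.
- exact/(subsetP subA)/f1.
- by have := h1 u; rewrite in_setD uB uA => /(_ isT)/setDP[].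
- by rewrite f1 // f2.
- have uD : u \in A :\: B by rewrite inE uB.
  by case/setDP: (h1 u uD) => _ /negPf->; rewrite h2.
- by move=> k; rewrite ffunE stableE // uB f3.
- by move=> k; rewrite ffunE stableE // (negPf uB) h3 // inE uB.
- by rewrite (subsetP subA) in uA.
- by rewrite h4 // inE (negPf uA) andbF.
Qed.

(** Roots are sorted by their value at a chosen [x]. A value inside the orbit of [x] uses up one
    orbit of its type and a value outside uses up two, which is [matching_polyS]. The condition for
    [c i = 0] fixes [m i] where the point count says nothing about it. *)
Theorem card_eqroots (I : finType) (ty : X -> I) (s c : I -> nat) :
  (forall x y, same_stab act act x y = (ty x == ty y)) ->
  (forall x, #|orb act x| = c (ty x)) ->
  (forall x, #|[set y in orb act x | local_root x y]| = s (ty x)) ->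
  forall (A : {set X}) (m : I -> nat), stable act A ->
  (forall i, c i = 0%N -> m i = 0%N) ->
  (forall i, #|[set x in A | ty x == i]| = c i * m i)%N ->
  #|eqroots A| = (\prod_i matching_poly (s i) (c i) (m i))%N.
Proof.
move=> tyS tyc tys A; have [n] := ubnP #|A|.
elim: n A => // n IH A ltA m sA c0 cm.
have tyA k x : ty (act k x) = ty x.
  apply/esym/eqP; rewrite -tyS; apply: same_stab_act.
  by apply/same_stabP.
have [A0|[x xA]] := set_0Vmem A.
  rewrite A0 eqroots0 big1 // => i _; have /esym/eqP := cm i.
  rewrite A0 (_ : [set _ in _ | _] = set0) ?cards0 ?muln_eq0; last first.
    by apply/setP => u; rewrite !inE.
  by case/orP => /eqP; [move/c0|] => ->.
set i := ty x; have subA := orb_sub sA xA.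
have ci : (0 < c i)%N by rewrite -tyc; apply/card_gt0P; exists x; apply: orb_refl.
case mi : (m i) => [|p].
  have /eqP := cm i; rewrite mi muln0 cards_eq0 => /eqP/setP/(_ x).
  by rewrite !inE xA eqxx.
(* The orbit counts once only [q] orbits of type [i] are left. *)
pose upd q j := if j == i then q else m j.
have ltD (B : {set X}) : orb act x \subset B -> (#|A :\: B| < n)%N.
  move=> /subsetP sub; rewrite -ltnS; apply: leq_trans ltA; rewrite ltnS.
  apply: proper_card; rewrite properE subsetDl; apply/subsetPn; exists x => //.
  by rewrite inE sub // orb_refl.
have IHupd q B : stable act B -> (#|B| < n)%N ->
    (forall j, #|[set u in B | ty u == j]| = c j * upd q j)%N ->
    #|eqroots B| = (matching_poly (s i) (c i) q *
      \prod_(j | j != i) matching_poly (s j) (c j) (m j))%N.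
  move=> sB ltB cB; rewrite (IH B ltB (upd q)) //.
    rewrite (bigD1 i) //= /upd eqxx; congr muln.
    by apply: eq_bigr => j /negPf->.
  move=> j; rewrite /upd; case: eqP => [->|_ /c0//].
  by move=> ci0; rewrite ci0 in ci.
have cD1 j : #|[set u in A :\: orb act x | ty u == j]| = (c j * upd p j)%N.
  rewrite card_type_setD_orb // cm tyc /upd (eq_sym j) -/i.
  by case: eqP => [<-|_]; rewrite ?subn0 // mi mulnS mul1n addKn.
have cD2 y j : y \in A :\: orb act x -> ty y = i ->
    #|[set u in A :\: (orb act x :|: orb act y) | ty u == j]| = (c j * upd p.-1 j)%N.
  move=> yD yi; rewrite -setDDl card_type_setD_orb //; last first.
    by apply: orb_sub => //; apply: stableD => //; apply: stable_orb.
  rewrite cD1 tyc yi /upd (eq_sym j); case: eqP => [<-|_]; last by rewrite subn0.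
  by rewrite mul1n -[X in (_ - X)%N]muln1 -mulnBr subn1.
have sO y : stable act (orb act y) by apply: stable_orb.
have -> : #|eqroots A| = (\sum_(y in A) #|[set f in eqroots A | f x == y]|)%N.
  rewrite -sum1_card (partition_big (fun f : {ffun X -> X} => f x) (mem A)) /=.
    by apply: eq_bigr => y _; rewrite -sum1_card; apply: eq_bigl => f; rewrite in_set.
  by move=> f /eqrootsP[h _ _ _]; apply: h.
rewrite (bigID (root_value x)) /= [X in (_ + X)%N]big1 ?addn0; last first.
  move=> y /andP[_ ny]; apply/eqP; rewrite cards_eq0; apply/eqP/setP => f.
  rewrite in_set [RHS]inE; apply/negP => /andP[fA /eqP fx]; case/negP: ny.
  by rewrite -fx; apply: root_valueP fA _.
rewrite (bigID (mem (orb act x))) /=.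
rewrite [RHS](bigD1 i) //= mi matching_polyS mulnDl.
congr addn.
  rewrite (eq_bigr (fun=> #|eqroots (A :\: orb act x)|)); last first.
    move=> y /andP[/andP[yA yr] yO]; rewrite card_eqroots_value // (eq_orb actP yO).
    by rewrite setUid.
  rewrite sum_nat_const (IHupd p) ?ltD //; last exact: stableD.
  rewrite -mulnA; congr muln; rewrite -[RHS]tys; apply: eq_card => y.
  rewrite !inE; apply/andP/andP => [[/andP[_ /andP[_ /implyP h]] yO]|[yO yl]].
    by split=> //; apply: h.
  by rewrite (subsetP subA) // /root_value yl implybT tyS; case/orbP: yO => k ->;
    rewrite tyA eqxx mem_orb.
(* Outside the orbit of [x] the local condition is vacuous, so the values are all [c i * p] points
   of the other [p] orbits of type [i]. *)
have yP y : (y \in A) && root_value x y && (y \notin orb act x) =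
            (y \in [set u in A :\: orb act x | ty u == i]).
  rewrite !inE /root_value tyS (eq_sym (ty y)) -/i.
  by case: (y \in orb act x) => /=; rewrite ?andbF // !andbT.
under eq_bigl do rewrite yP.
rewrite (eq_bigr (fun=> (matching_poly (s i) (c i) p.-1 *
      \prod_(j | j != i) matching_poly (s j) (c j) (m j))%N)); last first.
  move=> y; rewrite -yP => /andP[/andP[yA yr] yO].
  rewrite card_eqroots_value // (IHupd p.-1) //.
  - exact/stableD/stableU.
  - by apply: ltD; apply: subsetUl.
  - move=> j; apply: cD2; first by rewrite inE yO.
    by case/andP: yr; rewrite tyS => /eqP.
by rewrite sum_nat_const cD1 /upd eqxx mulnA.
Qed.
End Roots.
End Action.

(** * Coloured permutations as equivariant permutations *)

(** Reduce [a] modulo the orbit length; the iterates of [x] below that length are distinct. *)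
Lemma expg_porbit_fixed (T : finType) (s : {perm T}) x a :
  ((s ^+ a)%g x == x) = (#|porbit s x| %| a)%N.
Proof.
set j := #|porbit s x|.
have j0 : (0 < j)%N by rewrite lt0n card_porbit_neq0.
have sq q : (s ^+ (q * j))%g x = x.
  rewrite permX; elim: q => // q IH.
  by rewrite mulSn iterD IH iter_porbit.
rewrite {1}(divn_eq a j) expgD permM sq /dvdn permX.
have lt : (a %% j < j)%N by rewrite ltn_mod.
have := uniq_traject_porbit s x; rewrite -/j => u.
rewrite -(nth_traject s lt x) -[X in _ == X]/(iter 0 s x) -(nth_traject s j0 x).
by rewrite nth_uniq ?size_traject.
Qed.

Lemma big_porbit (V : zmodType) (T : finType) (s : {perm T}) x (F : T -> V) :
  \sum_(u in porbit s x) F u = \sum_(i < #|porbit s x|) F ((s ^+ i)%g x).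
Proof.
rewrite (eq_bigl (mem (traject s x #|porbit s x|))); last exact: porbit_traject.
rewrite -big_uniq ?uniq_traject_porbit //= (big_nth x) size_traject big_mkord.
by apply: eq_bigr => i _; rewrite nth_traject // permX.
Qed.

Section Gamma.
Variables (r n : nat).
Local Notation X := ('I_n * Defs.col r)%type.
Implicit Types (g p : Grn r n) (x : X).

(** The colour is read at the point of arrival; this turns [gmul] into composition ([gfunM]). *)
Definition gfun g x : X := (g.2 x.1, x.2 + g.1 (g.2 x.1)).

Lemma gfun_inj g : injective (gfun g).
Proof.
move=> [x c] [y d] e; have /= /perm_inj exy := congr1 fst e.
by have /= := congr1 snd e; rewrite exy => /addIr ->.
Qed.

Lemma gfunM a b x : gfun (gmul a b) x = gfun a (gfun b x).
Proof. by rewrite /gfun /= ffunE permM permK addrA addrAC. Qed.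

Lemma gfun_faithful a b : gfun a =1 gfun b -> a = b.
Proof.
case: a b => [z s] [w p] e.
have -> : s = p by apply/permP => y; have /= := congr1 fst (e (y, 0)).
congr pair; apply/ffunP => y; have := e ((p^-1)%g y, 0); rewrite /gfun /= => e'.
have := congr1 fst e'; have := congr1 snd e' => /=.
by move=> e2 es; move: e2; rewrite es !add0r permKV.
Qed.

(** Shift-equivariance reduces [f] to its values at the pairs [(y, 0)]. If two of these have the
    same first component, a shift by the difference of colours makes the images equal, so the
    induced map on ['I_n] is injective. *)
Lemma gfun_surj (f : X -> X) : injective f ->
  (forall x c, f (x.1, x.2 + c) = ((f x).1, (f x).2 + c)) ->
  exists p, gfun p =1 f.
Proof.
move=> fi fs; pose h y := (f (y, 0)).1.
have hi : injective h.
  move=> y y' e; have := fs (y', 0) ((f (y, 0)).2 - (f (y', 0)).2).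
  rewrite /= [(f (y', 0)).2 + _]addrC subrK -[(f (y', 0)).1]/(h y') -e /h -surjective_pairing.
  by move/fi/(congr1 fst).
exists ([ffun i => (f ((perm hi)^-1%g i, 0)).2], perm hi) => -[y c].
rewrite /gfun /= ffunE permK permE /h.
by have := fs (y, 0) c; rewrite /= add0r addrC => ->.
Qed.

Definition gamma g : {perm X} := perm (@gfun_inj g).

Definition colsum g a (y : 'I_n) : Defs.col r := \sum_(i < a) g.1 ((g.2 ^+ i.+1)%g y).

Lemma gammaX g a x : (gamma g ^+ a)%g x = ((g.2 ^+ a)%g x.1, x.2 + colsum g a x.1).
Proof.
elim: a x => [|a IH] x; first by rewrite !expg0 !perm1 /colsum big_ord0 addr0 -surjective_pairing.
rewrite expgSr permM IH permE /gfun /= /colsum big_ord_recr /= addrA.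
by rewrite !expgSr !permM.
Qed.

Lemma colsumD g a b y : colsum g (a + b) y = colsum g a y + colsum g b ((g.2 ^+ a)%g y).
Proof.
rewrite /colsum big_split_ord /=; congr (_ + _); apply: eq_bigr => i _.
by rewrite -permM -expgD addnS.
Qed.

Definition clen g (y : 'I_n) := #|porbit g.2 y|.
Definition ccol g (y : 'I_n) : Defs.col r := \sum_(u in porbit g.2 y) g.1 u.

Lemma clen_gt0 g y : (0 < clen g y)%N.
Proof. by rewrite lt0n card_porbit_neq0. Qed.

(** The sum starts at [g.2 y] rather than [y], so the cycle is reindexed by [g.2]. *)
Lemma colsum_clen g y : colsum g (clen g y) y = ccol g y.
Proof.
rewrite /ccol (reindex_inj (@perm_inj _ g.2)) /=.
have e u : (g.2 u \in porbit g.2 y) = (u \in porbit g.2 y).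
  by rewrite -!eq_porbit_mem -(porbit_perm _ 1 u) expg1.
rewrite (eq_bigl _ _ e).
rewrite big_porbit; apply: eq_bigr => i _.
by rewrite expgSr permM.
Qed.
Lemma colsum_mulclen g q y : colsum g (q * clen g y) y = ccol g y *+ q.
Proof.
elim: q => [|q IH]; first by rewrite mul0n /colsum big_ord0.
rewrite mulSn colsumD colsum_clen mulrS; congr (_ + _).
suff -> : (g.2 ^+ clen g y)%g y = y by [].
by apply/eqP; rewrite expg_porbit_fixed dvdnn.
Qed.

Lemma clen_le g y : (clen g y <= n)%N.
Proof. by rewrite -[X in (_ <= X)%N]card_ord max_card. Qed.

(* A common period of all [gamma g], made larger than every cycle length so that
   cycle lengths are represented faithfully modulo it. *)
Definition period := (n.+1 * #|{perm X}|)%N.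

Lemma period_gt0 : (0 < period)%N.
Proof. by rewrite muln_gt0 /=; apply/card_gt0P; exists 1%g. Qed.

Lemma gamma_period g : (gamma g ^+ period.-1.+1 = 1)%g.
Proof.
rewrite (prednK period_gt0) /period mulnC expgM.
suff -> : (gamma g ^+ #|{perm X}| = 1)%g by rewrite expg1n.
by apply/eqP; rewrite -order_dvdn -cardsT order_dvdG ?inE.
Qed.

(** The group does not depend on [g], so stabilisers for two different elements can be compared. *)
Definition opr : finZmodType :=
  HB.pack ('I_(period.-1).+1 * Defs.col r)%type
    (GRing.Zmodule.on ('I_(period.-1).+1 * Defs.col r)%type)
    (Finite.on ('I_(period.-1).+1 * Defs.col r)%type).

(* Acts as [gamma g ^+ a] followed by the shift by [b]. *)
Definition mkopr a (b : Defs.col r) : opr := (inZp a, b).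

Definition cpact g (k : opr) x : X :=
  (((gamma g ^+ k.1)%g x).1, ((gamma g ^+ k.1)%g x).2 + k.2).

Lemma cpactE g a b x :
  cpact g (mkopr a b) x = ((g.2 ^+ a)%g x.1, x.2 + colsum g a x.1 + b).
Proof. by rewrite /cpact /= expg_mod ?gamma_period // gammaX. Qed.

Lemma oprE (k : opr) : k = mkopr k.1 k.2.
Proof.
case: k => a b; rewrite /mkopr; congr (_, _).
by apply: val_inj; rewrite /= modn_small.
Qed.

Lemma mkoprD a b a' b' : mkopr a b + mkopr a' b' = mkopr (a + a') (b + b').
Proof. by congr (_, _); apply: val_inj; rewrite /= modnDm. Qed.

Lemma cpact_is_act g : is_act (cpact g).
Proof.
split=> [x|k l x].
  by rewrite /cpact expg0 perm1 addr0 -surjective_pairing.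
rewrite (oprE k) (oprE l) mkoprD !cpactE /= addnC expgD permM colsumD.
by congr pair; rewrite -!addrA; congr (_ + (_ + _)); rewrite [RHS]addrC -addrA.
Qed.

(** A point returns only after full turns of its cycle; each turn adds the cycle colour, which the
    shift has to cancel. *)
Lemma cpact_fixed g k x : (cpact g k x == x) =
  (clen g x.1 %| k.1)%N && (ccol g x.1 *+ (k.1 %/ clen g x.1) + k.2 == 0).
Proof.
rewrite {1}(oprE k) cpactE [in LHS](surjective_pairing x) xpair_eqE /=.
rewrite expg_porbit_fixed -/(clen g x.1); case: (boolP (_ %| _)%N) => //= d.
rewrite -{1}(divnK d) colsum_mulclen -addrA.
by rewrite -{2}[x.2]addr0 (inj_eq (addrI _)).
Qed.

(** One full turn followed by minus the cycle colour is in the stabiliser. Reading this element in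
    the other stabiliser gives divisibility of the lengths both ways, then equality of colours. *)
Lemma same_stab_cpact g g' x y : same_stab (cpact g) (cpact g') x y =
  (ccol g x.1 == ccol g' y.1) && (clen g x.1 == clen g' y.1).
Proof.
apply/idP/andP => [/same_stabP h|[/eqP e /eqP e']]; last first.
  by apply/same_stabP => k; split => /eqP; rewrite cpact_fixed => h; apply/eqP;
    rewrite cpact_fixed ?e ?e' // -?e -?e'.
have small a : (a <= n)%N -> (a %% period.-1.+1)%N = a.
  move=> an; rewrite modn_small // prednK ?period_gt0 //.
  apply: (@leq_trans n.+1) => //; rewrite leq_pmulr //.
  by apply/card_gt0P; exists 1%g.
have fixed p (u : X) : cpact p (mkopr (clen p u.1) (- ccol p u.1)) u == u.
  rewrite cpact_fixed /= small ?clen_le // dvdnn divnn clen_gt0.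
  by rewrite mulr1n subrr eqxx.
have := fixed g x => /eqP/h/eqP; rewrite cpact_fixed /= small ?clen_le //.
case/andP => d1 e.
have := fixed g' y => /eqP/h/eqP; rewrite cpact_fixed /= small ?clen_le //.
case/andP => d2 _.
have el : clen g x.1 = clen g' y.1 by apply/eqP; rewrite eqn_dvd d2 d1.
move: e; rewrite el divnn clen_gt0 mulr1n subr_eq0 => /eqP->.
by rewrite !eqxx.
Qed.

Lemma orb_cpact g x : orb (cpact g) x = setX (porbit g.2 x.1) setT.
Proof.
apply/setP => -[y c]; rewrite !inE andbT; apply/orbP/porbitP => [[k]|[a /= ->]].
  by rewrite (oprE k) cpactE => e; exists k.1; have := congr1 fst e.
exists (mkopr a (c - (x.2 + colsum g a x.1))); rewrite cpactE.
by congr pair; rewrite addrC subrK.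
Qed.

Lemma card_orb_cpact g x : #|orb (cpact g) x| = (r.-1.+1 * clen g x.1)%N.
Proof. by rewrite orb_cpact cardsX cardsT card_ord mulnC. Qed.

Definition kappa : opr := mkopr 1 0.

Lemma cpact_kappa g x : cpact g kappa x = gfun g x.
Proof.
by rewrite cpactE expg1 /colsum big_ord1 expg1 addr0.
Qed.

(** Moving [a] steps and shifting by [b] is a root only if [2 a = 1] modulo the cycle length [j]. So
    [j] is odd and [a] acts as [(j + 1) / 2]; two such moves make one turn too many, whence [2 b]
    plus the cycle colour vanishes. *)
Lemma card_local_root g x :
  #|[set y in orb (cpact g) x | local_root (cpact g) kappa x y]| =
  if odd (clen g x.1) then #|[set b : Defs.col r | b + b + ccol g x.1 == 0]| else 0%N.
Proof.
set j := clen g x.1; have aP := cpact_is_act g.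
have key a b : (cpact g (mkopr a b) (cpact g (mkopr a b) x) == cpact g kappa x) =
    ((g.2 ^+ (a + a))%g x.1 == g.2 x.1) && (colsum g (a + a) x.1 + (b + b) == colsum g 1 x.1).
  rewrite -(actD aP) mkoprD !cpactE expg1 xpair_eqE addr0 -addrA.
  by rewrite (inj_eq (addrI _)).
have odd_half a : (g.2 ^+ (a + a))%g x.1 = g.2 x.1 ->
   odd j /\ (g.2 ^+ a)%g x.1 = (g.2 ^+ uphalf j)%g x.1.
  move=> e; have mod2a : a + a = 1 %[mod j].
    have : (j %| a + a + j.-1)%N.
      rewrite -expg_porbit_fixed expgD permM e -permM -expgS prednK ?clen_gt0 //.
      by rewrite expg_porbit_fixed.
    have e1 : (a + a + j.-1 + 1 = a + a + j)%N.
      by rewrite -addnA addn1 prednK ?clen_gt0.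
    by move=> /eqP d; rewrite -(modnDr (a + a) j) -e1 -modnDml d.
  have oj : odd j.
    apply: contraT => oj; have := congr1 odd (divn_eq (a + a) j).
    have := congr1 odd (divn_eq 1 j).
    by rewrite !oddD !oddM (negPf oj) !andbF /= addbb -mod2a => <-.
  split=> //; have hj : (uphalf j).*2 = j.+1 by rewrite uphalfE halfK /= oj.
  suff am : a = uphalf j %[mod j].
    have fx q : (g.2 ^+ (q * j))%g x.1 = x.1.
      by apply/eqP; rewrite expg_porbit_fixed dvdn_mull.
    by rewrite (divn_eq a j) (divn_eq (uphalf j) j) am !expgD !permM !fx.
  (* [uphalf j] is the inverse of 2 modulo the odd [j]. *)
  have : (a + a) * uphalf j = 1 * uphalf j %[mod j].
    by rewrite -modnMml mod2a modnMml.
  by rewrite mul1n addnn -doubleMl doubleMr hj mulnS addnC modnMDl.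
case: ifPn => oj; last first.
  apply/eqP; rewrite cards_eq0; apply/eqP/setP => y; rewrite !inE.
  apply/negP => /andP[_ /existsP[k /andP[/eqP <-]]].
  by rewrite (oprE k) key => /andP[/eqP /odd_half[oj' _] _]; rewrite oj' in oj.
have jE : (uphalf j + uphalf j)%N = (j + 1)%N.
  by rewrite addnn uphalfE halfK /= oj addn1.
have sj : (g.2 ^+ j)%g x.1 = x.1 by apply/eqP; rewrite expg_porbit_fixed.
have keyh b : (cpact g (mkopr (uphalf j) b) (cpact g (mkopr (uphalf j) b) x)
    == cpact g kappa x) = (b + b + ccol g x.1 == 0).
  rewrite key jE expgD permM sj expg1 eqxx /= colsumD sj colsum_clen.
  by rewrite -{2}[colsum g 1 x.1]add0r addrAC (inj_eq (addIr _)) addrC.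
pose F b := cpact g (mkopr (uphalf j) b) x.
rewrite -(card_imset (f := F)); last first.
  by move=> b b'; rewrite /F !cpactE => /(congr1 snd) /= /addrI.
apply: eq_card => y; apply/idP/imsetP => [|[b bP ->]].
  rewrite inE => /andP[_ /existsP[k /andP[/eqP <-]]].
  (* The element [k] may use other exponents; [b] is the shift for which [mkopr (uphalf j) b]
     reaches the same point from [x]. *)
  move=> root; pose b := (cpact g k x).2 - (x.2 + colsum g (uphalf j) x.1).
  have e : cpact g (mkopr (uphalf j) b) x = cpact g k x.
    have := root; rewrite [X in cpact g X _](oprE k) [X in cpact g _ (cpact g X _)](oprE k).
    rewrite key => /andP[/eqP /odd_half[_ eh] _].
    rewrite cpactE -eh [RHS]surjective_pairing; congr pair.
      by rewrite [in RHS](oprE k) cpactE.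
    by rewrite addrC subrK.
  by exists b; rewrite -?e // inE -keyh e (actC aP) e.
rewrite inE in bP; rewrite inE mem_orb; apply/existsP; exists (mkopr (uphalf j) b).
by rewrite eqxx keyh bP.
Qed.

End Gamma.

(** * The number of square roots by cycle type *)

Definition nhalf (r t : nat) : nat := if odd r then 1 else if odd t then 0 else 2.

(** Two solutions differ by some [d] with [2 d = 0] modulo [r], so [d] is 0 or, for even [r],
    [r / 2]. For even [r] the parity of [t] decides solvability. *)
Lemma card_halves r (t : Defs.col r) : (0 < r)%N ->
  #|[set b : Defs.col r | b + b + t == 0]| = nhalf r t.
Proof.
move=> r0; have rE : r.-1.+1 = r by rewrite prednK.
have modr m : (m %% r.-1.+1 = m %% r)%N by rewrite rE.
have eqE (b : Defs.col r) : (b + b + t == 0) = (r %| b + b + t)%N.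
  by rewrite -val_eqE /= modnDml modr.
have ltr (b : Defs.col r) : (b < r)%N by rewrite -[X in (_ < X)%N]rE ltn_ord.
have lt_t := ltr t.
have mk m : (m < r)%N -> exists b : Defs.col r, val b = m.
  by move=> mr; exists (inord m); rewrite /= inordK // rE.
have only (b c : Defs.col r) : (b + b + t == 0) -> (c + c + t == 0) ->
    (b <= c)%N -> b = c \/ (~~ odd r /\ val c = (b + r./2)%N).
  rewrite !eqE => /dvdnP[p ep] /dvdnP[q eq] bc; have := ltr c; have := ltr b => lb lc.
  have : (q = p \/ q = p.+1)%N by nia.
  case=> e; [left; apply: val_inj => /=; nia|right].
  have : r = (c - b).*2 by nia.
  by move=> e2; split => /=; lia.
rewrite /nhalf; case: ifPn => odr.
  have [b bP] : exists b : Defs.col r, b + b + t == 0.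
    have [ot|et] := boolP (odd t).
      have [|b eb] := mk ((r - t)./2); first by lia.
      exists b; rewrite eqE eb; apply/dvdnP; exists 1%N; lia.
    have [t0|tp] := posnP t.
      have [|b eb] := mk 0%N; first by lia.
      by exists b; rewrite eqE eb t0.
    have [|b eb] := mk (r - t./2)%N; first by lia.
    exists b; rewrite eqE eb; apply/dvdnP; exists 2%N; lia.
  apply/eqP/cards1P; exists b; apply/setP => c; rewrite in_set in_set1.
  apply/idP/eqP => [cP|->//]; case: (leqP b c) => [bc|/ltnW cb].
    by case: (only _ _ bP cP bc) => [->//|[]]; rewrite odr.
  by case: (only _ _ cP bP cb) => [->//|[]]; rewrite odr.
case: ifPn => odt.
  apply/eqP; rewrite cards_eq0; apply/eqP/setP => b; rewrite in_set0 in_set eqE.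
  apply/negP => /dvdnP[q] /(congr1 odd).
  by rewrite oddM (negPf odr) andbF !oddD addbb odt.
have [b [bP br]] : exists b : Defs.col r, b + b + t == 0 /\ (b < r./2)%N.
  have [t0|tp] := posnP t.
    have [|b eb] := mk 0%N; first by lia.
    by exists b; rewrite eqE eb t0; split => //; lia.
  have [|b eb] := mk (r./2 - t./2)%N; first by lia.
  exists b; rewrite eqE eb; split; last by lia.
  apply/dvdnP; exists 1%N; lia.
have [|c ec] := mk (b + r./2)%N; first by lia.
have cP : c + c + t == 0.
  move: bP; rewrite !eqE ec => /dvdnP[q eq]; apply/dvdnP; exists q.+1; lia.
have ne : b != c by rewrite -val_eqE /= ec; lia.
rewrite (_ : [set _ | _] = [set b; c]) ?cards2 ?ne //.
apply/setP => d; rewrite in_set in_set2; apply/idP/orP => [dP|[]/eqP->//].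
case: (leqP b d) => [bd|/ltnW db].
  case: (only _ _ bP dP bd) => [->|[_ e]]; first by left.
  by right; rewrite -val_eqE /= e ec.
case: (only _ _ dP bP db) => [->|[_ e]]; first by left.
by move: e br => /= ->; lia.
Qed.

Section Count.
Variables (r n : nat).
Hypothesis r0 : (0 < r)%N.
Local Notation X := ('I_n * Defs.col r)%type.
Implicit Types (g p : Grn r n) (x : X).

(* The index of the variable [x_{t,j}] attached to the cycle of [x]. *)
Definition ty g x : 'I_(NX r n) := inord (ccol g x.1 * NV n + clen g x.1).

Lemma ccol_lt g y : (ccol g y < r)%N.
Proof. by rewrite -[X in (_ < X)%N](prednK r0) ltn_ord. Qed.

Lemma clen_lt g y : (clen g y < NV n)%N.
Proof. by have := clen_le g y; rewrite /NV; lia. Qed.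

Lemma val_ty g x : val (ty g x) = (ccol g x.1 * NV n + clen g x.1)%N.
Proof.
rewrite /= inordK // /NX ltnS; have := ccol_lt g x.1; have := clen_lt g x.1.
by move: (nat_of_ord (ccol g x.1)) (NV n) => a b; nia.
Qed.

Lemma ty_eq g x (i : 'I_(NX r n)) : (ty g x == i) =
  (val (ccol g x.1) == i %/ NV n)%N && (clen g x.1 == i %% NV n)%N.
Proof.
rewrite -val_eqE val_ty /=; apply/eqP/andP => [<-|[/eqP-> /eqP->]].
  by rewrite divnMDl // divn_small ?clen_lt // addn0 modnMDl modn_small ?clen_lt.
by rewrite -divn_eq.
Qed.

Lemma ty_divmod g x :
  (ty g x %/ NV n = ccol g x.1)%N /\ (ty g x %% NV n = clen g x.1)%N.
Proof. by have := eqxx (ty g x); rewrite {1}ty_eq => /andP[/eqP-> /eqP->]. Qed.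

Lemma same_stab_ty g g' x y :
  same_stab (cpact g) (cpact g') x y = (ty g x == ty g' y).
Proof.
by rewrite same_stab_cpact ty_eq; have [-> ->] := ty_divmod g' y; rewrite val_eqE.
Qed.

Lemma mult_points g t j :
  (mult g t j * j)%N =
  #|[set y : 'I_n | (val (ccol g y) == t) && (clen g y == j)]|.
Proof.
rewrite /mult; set P := [set C in _ | _].
apply/esym/card_uniform_partition => [C|].
  by rewrite in_set => /and3P[_ /eqP].
have memP C : C \in P -> exists2 y, C = porbit g.2 y &
    (val (ccol g y) == t) && (clen g y == j).
  rewrite in_set => /and3P[/imsetP[y _ ->] h1 h2]; exists y => //.
  by rewrite h1 andbT.
apply/and3P; split.
- apply/eqP/setP => y; apply/bigcupP/idP => [[C /memP[u -> h]]|].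
    rewrite -eq_porbit_mem => /eqP e; rewrite in_set.
    by rewrite /ccol /clen e.
  rewrite in_set => /andP[h1 h2]; exists (porbit g.2 y); last exact: porbit_id.
  by rewrite in_set h2 imset_f.
- apply/trivIsetP => _ _ /memP[y -> _] /memP[u -> _] ne.
  apply/pred0P => v /=; apply/negP => /andP[]; rewrite -!eq_porbit_mem.
  by move=> /eqP e1 /eqP e2; rewrite -e1 e2 eqxx in ne.
- by apply/negP => /memP[y /setP/(_ y)]; rewrite porbit_id in_set0.
Qed.

Lemma card_ty g i :
  #|[set x in [set: X] | ty g x == i]| = (r * (i %% NV n) * ctype_monom g i)%N.
Proof.
rewrite mnmE -mulnA [X in (_ * X)%N]mulnC mult_points.
rewrite -[X in (X * _)%N](prednK r0) -[X in (X * _)%N]card_ord -cardsT mulnC -cardsX.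
by apply: eq_card => -[y c]; rewrite !inE ty_eq andbT.
Qed.

(** Cycles are nonempty; this covers the indices at which [card_ty] only says [0 = 0]. *)
Lemma ctype_monom0 g (i : 'I_(NX r n)) : (i %% NV n = 0)%N -> ctype_monom g i = 0%N.
Proof.
move=> i0; rewrite mnmE i0; apply/eqP; rewrite cards_eq0; apply/eqP/setP => C.
rewrite in_set0 in_set; apply/negP => /and3P[/imsetP[y _ ->] /eqP e _].
by have := card_porbit_neq0 g.2 y; rewrite e.
Qed.

Lemma cpact_equivariant g g' p :
  (forall x, gfun p (gfun g x) = gfun g' (gfun p x)) ->
  forall k x, gfun p (cpact g k x) = cpact g' k (gfun p x).
Proof.
move=> e k x; rewrite /cpact.
have -> : (gamma g' ^+ k.1)%g (gfun p x) = gfun p ((gamma g ^+ k.1)%g x).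
  elim: (nat_of_ord k.1) => [|a IH]; first by rewrite !expg0 !perm1.
  by rewrite !expgSr !permM IH !permE e.
by rewrite /gfun /= addrAC.
Qed.

(** A square root of [g] commutes with [g], so its map is equivariant. Conversely a root [f] is
    injective because [f \o f] is, and equivariance under shifts makes it come from an element of
    the group. *)
Lemma nsqrt_eqroots g : nsqrt g = #|eqroots (cpact g) (kappa r n) setT|.
Proof.
pose F p := [ffun x : X => gfun p x].
have Fi : injective F.
  by move=> p q /ffunP e; apply: gfun_faithful => x; have := e x; rewrite !ffunE.
rewrite /nsqrt -(card_imset _ Fi); apply: eq_card => f.
apply/imsetP/eqrootsP => [[p]|[_ h2 h3 _]].
  rewrite in_set => /eqP pg ->; split => x; rewrite ?in_setT //.
    by rewrite !ffunE cpact_kappa -pg gfunM.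
  by move=> _ k; rewrite !ffunE; apply: cpact_equivariant => y; rewrite -pg !gfunM.
have fi : injective f.
  move=> x y e; apply: (@gfun_inj _ _ g); rewrite -!cpact_kappa -!h2 ?in_setT //.
  by rewrite e.
have [x c|p pf] := gfun_surj fi.
  have := h3 x (in_setT x) (mkopr n 0 c); rewrite !cpactE.
  by rewrite !expg0 !perm1 /colsum !big_ord0 !addr0.
exists p; last by apply/ffunP => x; rewrite ffunE pf.
rewrite in_set; apply/eqP/gfun_faithful => x.
by rewrite gfunM !pf h2 ?in_setT // cpact_kappa.
Qed.

Definition nroot1 (i : nat) : nat :=
  if odd (i %% NV n) then nhalf r (i %/ NV n) else 0.

Lemma nsqrt_prod g : nsqrt g =
  (\prod_(i < NX r n) matching_poly (nroot1 i) (r * (i %% NV n)) (ctype_monom g i))%N.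
Proof.
rewrite nsqrt_eqroots; apply: (card_eqroots (cpact_is_act g) (ty := ty g)).
- exact: same_stab_ty.
- by move=> x; have [_ ->] := ty_divmod g x; rewrite card_orb_cpact prednK.
- move=> x; rewrite card_local_root /nroot1; have [-> ->] := ty_divmod g x.
  by rewrite card_halves.
- by move=> k x; rewrite !in_setT.
- move=> i /eqP; rewrite muln_eq0 (gtn_eqF r0) /= => /eqP; exact: ctype_monom0.
- exact: card_ty.
Qed.
End Count.

(** * The multivariate generating function *)

(** The added terms have a zero binomial; a free range lets sums for consecutive [m] be compared
    termwise. *)
Lemma Rser_wide c m M : (m./2 < M)%N -> Rser c m =
  \sum_(k < M) ('C(m, 2 * k))%:R * (dfact (2 * k - 1))%:R * c ^+ k.
Proof.
move=> lt; rewrite /Rser.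
rewrite (big_ord_widen _ (fun k : nat => ('C(m, 2 * k))%:R * (dfact (2 * k - 1))%:R * c ^+ k) lt).
rewrite big_mkcond; apply: eq_bigr => k _; case: ifPn => // h.
by rewrite bin_small ?mul0r //; lia.
Qed.

Lemma dfact_odd k : dfact (2 * k).+1 = ((2 * k).+1 * dfact (2 * k - 1))%N.
Proof.
case: k => // k; have -> : (2 * k.+1 = (2 * k).+2)%N by lia.
by rewrite subn1.
Qed.

(** Pascal's rule splits each term, and the absorption identity for binomials turns the second half
    into a term for [m]. *)
Lemma RserSS c m :
  Rser c m.+2 = Rser c m.+1 + m.+1%:R * c * Rser c m.
Proof.
rewrite (Rser_wide c (M := m.+2)) /=; last by lia.
rewrite (Rser_wide c (m := m.+1) (M := m.+2)); last by rewrite /=; lia.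
rewrite (Rser_wide c (m := m) (M := m.+1)); last by lia.
rewrite !(big_ord_recl m.+1) /= !bin0 -addrA; congr (_ + _).
rewrite mulr_sumr -big_split /=; apply: eq_bigr => k _.
have -> : (2 * bump 0 k = (2 * k).+2)%N by rewrite /bump /=; lia.
have -> : ((2 * k).+2 - 1 = (2 * k).+1)%N by lia.
rewrite binS natrD [bump 0 k]/bump add1n exprS !mulrDl; congr (_ + _).
rewrite dfact_odd.
have := mul_bin_diag m.+1 (2 * k); rewrite /= => e.
rewrite -natrM mulnA [('C(_, _) * _)%N]mulnC -e !natrM; ring.
Qed.

Lemma Rser0 c : Rser c 0 = 1.
Proof. by rewrite /Rser big_ord1 /= expr0 !mulr1. Qed.
Lemma Rser1 c : Rser c 1 = 1.
Proof. by rewrite /Rser big_ord1 /= expr0 !mulr1. Qed.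

Lemma nat_ind2 (P : nat -> Prop) : P 0%N -> P 1%N ->
  (forall m, P m -> P m.+1 -> P m.+2) -> forall m, P m.
Proof.
move=> P0 P1 PS m; suff [] : P m /\ P m.+1 by [].
by elim: m => // m [h1 h2]; split=> //; apply: PS.
Qed.

Lemma matching_poly1 c m : (matching_poly 1 c m)%:R = Rser c%:R m.
Proof.
elim/nat_ind2: m => [||m IH IH']; rewrite ?Rser0 ?Rser1 //.
by rewrite matching_polyS RserSS natrD !natrM IH IH' mul1r (mulrC c%:R).
Qed.

(** Extracting a factor 2 for every point takes 4 from every pair, whose weight becomes [c / 4]. *)
Lemma matching_poly2 c m :
  (matching_poly 2 c m)%:R = Rser (c%:R / 4%:R) m * 2%:R ^+ m.
Proof.
elim/nat_ind2: m => [||m IH IH']; rewrite ?Rser0 ?Rser1 ?mul1r //.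
by rewrite matching_polyS RserSS natrD !natrM IH IH' !exprS; field.
Qed.

(** With fixed points of weight 0 only perfect matchings remain. *)
Lemma matching_poly0 c m : (matching_poly 0 c m)%:R =
  if odd m then 0 else Dser m./2 * c%:R ^+ m./2.
Proof.
elim/nat_ind2: m => [||m IH _] //.
rewrite matching_polyS natrD !natrM IH mul0r add0r oddS oddS negbK.
case: ifPn => om; first by rewrite mulr0.
rewrite /= /Dser exprS.
have -> : (2 * (m./2).+1 - 1 = (2 * m./2).+1)%N by lia.
have -> : dfact (2 * m./2).+1 = (m.+1 * dfact (2 * m./2 - 1))%N.
  by rewrite dfact_odd; congr (_.+1 * _)%N; lia.
by rewrite natrM; ring.
Qed.

(** * Coefficients of products of one-variable factors *)

Section Coefficients.
Variables (R : comNzRingType) (N M : nat).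

(** Expanding chooses one exponent per variable, and only the choice given by [m] yields the
    monomial [m]. *)
Lemma mcoeff_prod_univariate (a : 'I_N -> nat -> R) (m : 'X_{1..N}) :
  (forall i, (m i < M)%N) ->
  (\prod_(i < N) \sum_(k < M) a i k *: ('X_i : {mpoly R[N]}) ^+ k)@_m =
  \prod_(i < N) a i (m i).
Proof.
move=> lt; rewrite bigA_distr_bigA /= raddf_sum /=.
pose f0 : {ffun 'I_N -> 'I_M} := [ffun i => Ordinal (lt i)].
have E (f : {ffun 'I_N -> 'I_M}) :
    (\prod_i (a i (f i) *: ('X_i : {mpoly R[N]}) ^+ f i))@_m =
    (\prod_i a i (f i)) * (f == f0)%:R.
  rewrite scaler_prod mcoeffZ; congr (_ * _).
  rewrite (_ : \prod_i _ = 'X_[[multinom (f i : nat) | i < N]]); last first.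
    by rewrite mpolyXE_id; apply: eq_bigr => i _; rewrite mnmE.
  rewrite mcoeffX; congr (nat_of_bool _)%:R; apply/eqP/eqP => [e|->].
    by apply/ffunP => i; apply: val_inj; rewrite ffunE /= -e mnmE.
  by apply/mnmP => i; rewrite mnmE ffunE.
rewrite (bigD1 f0) //= E eqxx mulr1 [X in _ + X]big1 ?addr0; last first.
  by move=> f /negPf nf; rewrite E nf mulr0.
by apply: eq_bigr => i _; rewrite ffunE.
Qed.
End Coefficients.

Lemma big_ord_double (R : nmodType) n (F : nat -> R) :
  \sum_(k < n.*2) F k = \sum_(k < n) (F k.*2 + F k.*2.+1).
Proof.
elim: n => [|n IH]; first by rewrite !big_ord0.
by rewrite doubleS !big_ord_recr IH /= addrA.
Qed.

Section Factors.
Variables (A : comAlgType rat) (n : nat).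
Implicit Type x : A.

(** A common shape for both series: [2 n + 2] terms hold a series in [c x^2] truncated at [n], and a
    series in [c x] is padded with zeros. *)
Definition factor (b : nat -> rat) x := \sum_(k < n.+1.*2) b k *: x ^+ k.

Lemma trunc_eval_sqr a c x : trunc_eval a n (c *: x ^+ 2) =
  factor (fun k => if odd k then 0 else a k./2 * c ^+ k./2) x.
Proof.
rewrite /factor (big_ord_double n.+1
  (fun k => (if odd k then 0 else a k./2 * c ^+ k./2) *: x ^+ k)).
apply: eq_bigr => k _; rewrite odd_double oddS odd_double scale0r addr0 doubleK.
by rewrite exprZn scalerA -exprM mul2n.
Qed.

Lemma trunc_eval_lin a c x : trunc_eval a n (c *: x) =
  factor (fun k => if (k <= n)%N then a k * c ^+ k else 0) x.
Proof.
rewrite /factor -(big_mkord xpredT (fun k => (if (k <= n)%N then a k * c ^+ k else 0) *: x ^+ k)).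
rewrite (big_cat_nat (n := n.+1)) //=; last by lia.
rewrite [X in _ + X]big_nat_cond [X in _ + X]big1 ?addr0; last first.
  by move=> k /andP[/andP[lt _] _]; rewrite leqNgt lt scale0r.
rewrite big_mkord; apply: eq_bigr => k _.
by rewrite -ltnS ltn_ord exprZn scalerA.
Qed.
End Factors.

Lemma big_nat_mul_blocks (R : Type) (idx : R) (op : Monoid.com_law idx) r m (F : nat -> R) :
  \big[op/idx]_(0 <= i < r * m) F i =
  \big[op/idx]_(t < r) \big[op/idx]_(0 <= j < m) F (t * m + j)%N.
Proof.
elim: r => [|r IH]; first by rewrite mul0n big_nil big_ord0.
rewrite big_ord_recr -IH /= mulSnr (big_cat_nat (n := r * m)) //=; last by lia.
congr (op _ _); rewrite -{1}[(r * m)%N]add0n big_addn addKn.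
by apply: eq_bigr => j _; rewrite addnC.
Qed.

Lemma big_nat_odd_even (R : Type) (idx : R) (op : Monoid.com_law idx) n (F : nat -> R) :
  F 0%N = idx ->
  \big[op/idx]_(0 <= j < (2 * n).+1) F j =
  \big[op/idx]_(1 <= k < n.+1) op (F (2 * k)%N) (F (2 * k - 1)%N).
Proof.
move=> F0; elim: n => [|n IH]; first by rewrite big_nat1 F0 big_geq.
rewrite [RHS]big_nat_recr //= -IH (_ : 2 * n.+1 = (2 * n).+2)%N; last by lia.
rewrite big_nat_recr //= big_nat_recr //= -Monoid.mulmA subn1.
by rewrite [X in op _ X = _]Monoid.mulmC.
Qed.

Section MultiGF.
Variables (r n : nat).

(** The coefficient of the [k]-th power of variable [i] in the truncated product. The cut-off
    [k <= n] is the truncation of the R series, and [1 ^+ k] is the form in which [trunc_eval_lin]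
    produces it. *)
Definition fcoef (i k : nat) : rat :=
  let t := (i %/ NV n)%N in let j := (i %% NV n)%N in
  if j == 0%N then (k == 0%N)%:R
  else if odd j && (odd r || ~~ odd t) then
    if (k <= n)%N then
      if odd r then Rser (r * j)%:R k * 1 ^+ k
      else Rser ((r * j)%:R / 4%:R) k * 2%:R ^+ k
    else 0
  else if odd k then 0 else Dser k./2 * (j * r)%:R ^+ k./2.

(** Types with 0, 1 or 2 roots per orbit give the series D, the series R, and R at twice the
    variable. *)
Lemma fcoef_matching_poly i k : (k <= n)%N -> (i %% NV n = 0 -> k = 0)%N ->
  (matching_poly (nroot1 r n i) (r * (i %% NV n)) k)%:R = fcoef i k.
Proof.
move=> kn k0; rewrite /fcoef /nroot1 /nhalf kn.
case: eqP => [/k0->//|_]; case: (odd (_ %% _)) => /=; last first.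
  by rewrite matching_poly0 mulnC.
case: (odd r) => /=; first by rewrite matching_poly1 expr1n mulr1.
by case: (odd _) => /=; rewrite ?matching_poly2 ?matching_poly0 // mulnC.
Qed.

Definition xfactor i : {mpoly rat[NX r n]} := factor n (fcoef i) 'X_(inord i).

Lemma xfactor0 i : (i %% NV n = 0)%N -> xfactor i = 1.
Proof.
move=> i0; rewrite /xfactor /factor /fcoef i0 /= big_ord_recl scale1r expr0 big1 ?addr0 //.
by move=> k _; rewrite scale0r.
Qed.

Lemma divmod_NV t j : (j <= 2 * n)%N ->
  ((t * NV n + j) %/ NV n = t)%N /\ ((t * NV n + j) %% NV n = j)%N.
Proof.
move=> jn; have lt : (j < NV n)%N by rewrite /NV; lia.
by rewrite divnMDl // divn_small // addn0 modnMDl modn_small.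
Qed.

Lemma xfactor_even t k : (1 <= k < n.+1)%N ->
  trunc_eval Dser n ((2 * k * r)%:R *: xv r n t (2 * k) ^+ 2) =
  xfactor (t * NV n + 2 * k).
Proof.
move=> kn; rewrite trunc_eval_sqr; apply: eq_bigr => i _; congr (_ *: _).
rewrite /fcoef; have [|-> ->] := @divmod_NV t (2 * k); first by lia.
have -> : (2 * k == 0)%N = false by lia.
by rewrite mul2n odd_double.
Qed.

Lemma xfactor_odd t k : (1 <= k < n.+1)%N ->
  xfactor (t * NV n + (2 * k - 1)) =
  if odd r then trunc_eval (Rser (r * (2 * k - 1))%:R) n (xv r n t (2 * k - 1))
  else if odd t then
    trunc_eval Dser n (((2 * k - 1) * r)%:R *: xv r n t (2 * k - 1) ^+ 2)
  else trunc_eval (Rser ((r * (2 * k - 1))%:R / 4%:R)) n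
         (2%:R *: xv r n t (2 * k - 1)).
Proof.
move=> kn; rewrite -[X in trunc_eval (Rser (r * _)%:R) n X]scale1r.
rewrite trunc_eval_sqr !trunc_eval_lin /xfactor /fcoef.
have [|-> ->] := @divmod_NV t (2 * k - 1); first by lia.
have -> : (2 * k - 1 == 0)%N = false by lia.
have -> : odd (2 * k - 1) by lia.
by case: (odd r) => //=; case: (odd t).
Qed.

Lemma sqrt_gf_multiE :
  sqrt_gf_multi r n = \prod_(i < NX r n) factor n (fcoef i) 'X_i.
Proof.
transitivity (\prod_(0 <= i < NX r n) xfactor i); last first.
  by rewrite big_mkord; apply: eq_bigr => i _; rewrite /xfactor inord_val.
(* The padding index [r * NV n] is 0 modulo [NV n], so its factor is 1. *)
rewrite /NX big_nat_recr //= xfactor0 ?modnMl // mulr1 big_nat_mul_blocks.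
rewrite (eq_bigr (fun t : 'I_r => \prod_(1 <= k < n.+1)
    (xfactor (t * NV n + 2 * k) * xfactor (t * NV n + (2 * k - 1))))); last first.
  move=> t _; apply: (@big_nat_odd_even _ _ _ n (fun j => xfactor (t * NV n + j))).
  by rewrite xfactor0 // addn0 modnMl.
rewrite exchange_big /sqrt_gf_multi /=; case: ifPn => odr.
  apply: eq_big_nat => k kn; apply: eq_bigr => t _.
  by rewrite xfactor_even // xfactor_odd // odr.
apply: eq_big_nat => k kn; rewrite big_split /= -mulrA; congr (_ * _).
  by apply: eq_bigr => t _; rewrite xfactor_even.
rewrite [RHS](bigID (fun t : 'I_r => odd t)) /=.
by congr (_ * _); apply: eq_bigr => t ot; rewrite xfactor_odd // (negPf odr) ?ot // (negPf ot).
Qed.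

Lemma sqrt_gf_multi_coef (r0 : (0 < r)%N) (g : Grn r n) :
  (nsqrt g)%:R = (sqrt_gf_multi r n)@_(ctype_monom g).
Proof.
(* The exponents stay within the truncation because [mult * j] counts points of ['I_n]. *)
have le_n i : (ctype_monom g i <= n)%N.
  have [/ctype_monom0->//|jp] := posnP (i %% NV n).
  rewrite mnmE; apply: (@leq_trans (mult g (i %/ NV n) (i %% NV n) * (i %% NV n))).
    exact: leq_pmulr.
  by rewrite mult_points -[X in (_ <= X)%N]card_ord max_card.
rewrite sqrt_gf_multiE.
rewrite (@mcoeff_prod_univariate _ _ n.+1.*2 (fun i : 'I_(NX r n) => fcoef i)); last first.
  by move=> i; have := le_n i; lia.
rewrite nsqrt_prod // natr_prod; apply: eq_bigr => i _.
by rewrite fcoef_matching_poly // => /ctype_monom0.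
Qed.
End MultiGF.

(** * Conjugacy classes and cycle types *)

Section Classes.
Variables (r n : nat).
Hypothesis r0 : (0 < r)%N.
Local Notation X := ('I_n * Defs.col r)%type.
Implicit Types (g p : Grn r n) (x : X) (m : 'X_{1..NX r n}).

Lemma gfun_ginvK p : cancel (gfun p) (gfun (ginv p)).
Proof. by move=> [y c]; rewrite /gfun /= !permK ffunE addrK. Qed.

Lemma gfun_ginvKV p : cancel (gfun (ginv p)) (gfun p).
Proof. by move=> [y c]; rewrite /gfun /= !permKV ffunE permKV subrK. Qed.

Lemma ty_cpact g k x : ty g (cpact g k x) = ty g x.
Proof.
apply/esym/eqP; rewrite -same_stab_ty //; apply: same_stab_act; last first.
  by apply/same_stabP.
exact: cpact_is_act.
Qed.

(** Equal cycle types give equally many points of each type, and an equivariant bijection between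
    them is a conjugating element. *)
Lemma conj_of_ctype g g' : ctype_monom g = ctype_monom g' ->
  exists p, g' = gmul (gmul p g) (ginv p).
Proof.
move=> e.
have [||||||||f [_ fi fk]] := @equivariant_bijection_exists _ _ X (cpact g)
    (cpact g') (ty g) (ty g') _ _ _ _ _ setT setT.
- exact: cpact_is_act.
- exact: cpact_is_act.
- exact: ty_cpact.
- exact: ty_cpact.
- by move=> x y exy; rewrite same_stab_ty // exy.
- by move=> k x _; rewrite in_setT.
- by move=> k x _; rewrite in_setT.
- by move=> i; rewrite !card_ty // e.
have fk' x k : f (cpact g k x) = cpact g' k (f x) by apply: fk; rewrite in_setT.
have [||p pf] := @gfun_surj _ _ f.
- by move=> x y; apply: fi; rewrite in_setT.
- move=> x c; have := fk' x (mkopr n 0 c); rewrite !cpactE.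
  by rewrite !expg0 !perm1 /colsum !big_ord0 !addr0.
exists p; apply: gfun_faithful => x.
by rewrite !gfunM pf -(cpact_kappa g) fk' cpact_kappa -pf gfun_ginvKV.
Qed.

Lemma ctype_of_card g m :
  (forall i : 'I_(NX r n), (i %% NV n = 0)%N -> m i = 0%N) ->
  (forall i, #|[set x in [set: X] | ty g x == i]| = (r * (i %% NV n) * m i)%N) ->
  ctype_monom g = m.
Proof.
move=> m0 mc; apply/mnmP => i; have [j0|jp] := posnP (i %% NV n).
  by rewrite m0 // ctype_monom0.
apply/eqP; rewrite -(@eqn_pmul2l (r * (i %% NV n))) ?muln_gt0 ?r0 //.
by rewrite -card_ty // mc.
Qed.

Lemma ctype_monom_conj p g : ctype_monom (gmul (gmul p g) (ginv p)) = ctype_monom g.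
Proof.
set g' := gmul _ _; apply: ctype_of_card => i; first exact: ctype_monom0.
rewrite -card_ty // -(card_imset _ (@gfun_inj _ _ (ginv p))).
have eqv y : gfun p (gfun g y) = gfun g' (gfun p y) by rewrite !gfunM gfun_ginvK.
have tyE x : ty g x = ty g' (gfun p x).
  apply/eqP; rewrite -same_stab_ty //; apply/same_stabP => k.
  rewrite -(cpact_equivariant eqv); split=> [->//|]; exact: gfun_inj.
apply: eq_card => x; apply/imsetP/idP => [[y]|].
  by rewrite !inE => yi ->; rewrite tyE gfun_ginvKV.
by rewrite !inE => xi; exists (gfun p x); rewrite ?gfun_ginvK // !inE -tyE.
Qed.

Lemma conj_class_refl g : g \in conj_class g.
Proof.
have one y : gfun (gone r n) y = y.
  by case: y => a b; rewrite /gfun /= perm1 ffunE addr0.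
have inv1 y : gfun (ginv (gone r n)) y = y.
  by rewrite -[RHS](gfun_ginvKV (gone r n)) one.
apply/imsetP; exists (gone r n) => //; apply: gfun_faithful => x.
by rewrite !gfunM one inv1.
Qed.

Lemma ginvM p q : ginv (gmul q p) = gmul (ginv p) (ginv q).
Proof.
apply: gfun_faithful => x; apply: (@gfun_inj _ _ (gmul q p)).
by rewrite gfun_ginvKV !gfunM !gfun_ginvKV.
Qed.

Lemma conj_class_conj p g : conj_class (gmul (gmul p g) (ginv p)) = conj_class g.
Proof.
apply/setP => h; apply/imsetP/imsetP => -[q _ ->].
  by exists (gmul q p) => //; apply: gfun_faithful => x; rewrite ginvM !gfunM.
exists (gmul q (ginv p)) => //; apply: gfun_faithful => x.
by rewrite ginvM !gfunM gfun_ginvK (gfun_ginvKV (ginv p)).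
Qed.

(** A class contains the element defining it, so the default [gone] in [crepr] is never reached. *)
Lemma creprP C : C \in gclasses r n -> conj_class (crepr C) = C.
Proof.
case/imsetP => g _ ->; rewrite /crepr; case: pickP => [h|/(_ g)] /=; last first.
  by rewrite conj_class_refl.
by case/imsetP => p _ ->; rewrite conj_class_conj.
Qed.

(** Characterises the monomials of cycle types: [weighted_ctype] and [ctype_monom_exists] are the
    two directions. *)
Definition weighted m :=
  [forall i : 'I_(NX r n), (i %% NV n == 0)%N ==> (m i == 0%N)] &&
  (\sum_(i < NX r n) (i %% NV n) * m i == n)%N.

(** Both sides are multiplied by [r], so that the [r * n] points of [X] can be counted by type. *)
Lemma weighted_ctype g : weighted (ctype_monom g).
Proof.
apply/andP; split.
  by apply/forallP => i; apply/implyP => /eqP/ctype_monom0->.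
rewrite -(eqn_pmul2l r0) big_distrr /=; apply/eqP.
transitivity #|{: X}|; last by rewrite card_prod !card_ord prednK // mulnC.
rewrite -sum1_card (partition_big (ty g) xpredT) //=; apply: eq_bigr => i _.
rewrite mulnA -card_ty // -sum1_card; apply: eq_bigl => x.
by rewrite !inE.
Qed.

End Classes.

(** * Realising a prescribed cycle type *)

Lemma val_iter_ordS j a (b : 'I_j) : val (iter a (@ordS j) b) = ((b + a) %% j)%N.
Proof.
elim: a => [|a IH]; first by rewrite addn0 /= modn_small.
transitivity ((val (iter a (@ordS j) b)).+1 %% j)%N; first by [].
by rewrite IH addnS -(addn1 ((b + a) %% j)) modnDml addn1.
Qed.

Section Realize.
Variables (r n : nat).
Hypothesis r0 : (0 < r)%N.
Local Notation X := ('I_n * Defs.col r)%type.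

(* One cyclically permuted block ['I_j] for each of the [m i] prescribed cycles of
   type [i]; the whole colour of a cycle is carried by its point [0]. *)
Lemma ctype_monom_exists (m : 'X_{1..NX r n}) :
  weighted m -> exists g : Grn r n, ctype_monom g = m.
Proof.
case/andP => /forallP m0 /eqP mn.
pose TT (i : 'I_(NX r n)) : finType := ('I_(m i) * 'I_(i %% NV n))%type.
pose T : finType := {i : 'I_(NX r n) & TT i}.
have cT : #|T| = n.
  rewrite card_tagged sumnE big_map -[RHS]mn big_enum /=.
  by apply: eq_bigr => i _; rewrite card_prod !card_ord mulnC.
pose e (y : 'I_n) : T := enum_val (cast_ord (esym cT) y).
pose d (u : T) : 'I_n := cast_ord cT (enum_rank u).
have eK : cancel e d by move=> y; rewrite /e /d enum_valK cast_ordKV.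
have dK : cancel d e by move=> u; rewrite /e /d cast_ordK enum_rankK.
pose sT (u : T) : T := Tagged TT ((tagged u).1, ordS (tagged u).2).
have sTi : injective sT.
  apply: (can_inj (g := fun u : T => Tagged TT ((tagged u).1, ord_pred (tagged u).2))).
  by case=> i [q b]; rewrite /sT /= ordSK.
have si : injective (fun y => d (sT (e y))).
  by apply: inj_comp (can_inj dK) _; apply: inj_comp sTi (can_inj eK).
pose z : {ffun 'I_n -> Defs.col r} := [ffun y =>
  if val (tagged (e y)).2 == 0%N then inord (tag (e y) %/ NV n) else 0].
pose g : Grn r n := (z, perm si).
have iterT a (i : 'I_(NX r n)) (q : 'I_(m i)) (b : 'I_(i %% NV n)) :
    iter a sT (Tagged TT (q, b) : T) = Tagged TT (q, iter a (@ordS _) b) :> T.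
  by elim: a => // a IH; rewrite !iterS IH.
have gX a y : (g.2 ^+ a)%g y = d (iter a sT (e y)).
  rewrite permX; elim: a => [|a IH]; first by rewrite eK.
  by rewrite !iterS IH permE dK.
pose mk (i : 'I_(NX r n)) (q : 'I_(m i)) (b : 'I_(i %% NV n)) : T := Tagged TT (q, b).
have mki i q : injective (fun b => d (@mk i q b)).
  by move=> b b' /(can_inj dK) /eqP; rewrite eq_Tagged /= xpair_eqE eqxx /= => /eqP.
have porb i q b y : e y = @mk i q b ->
    porbit g.2 y = [set d (@mk i q c) | c : 'I_(i %% NV n)].
  move=> ey; apply/setP => u; apply/porbitP/imsetP => [[a ->]|[c _ ->]].
    by rewrite gX ey iterT; eexists.
  (* From [b], [j - b] steps lead to 0 modulo the block length [j], and [c] more lead to [c]. *)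
  exists (c + (i %% NV n - b))%N; rewrite gX ey iterT.
  suff -> : iter (c + (i %% NV n - b)) (@ordS _) b = c by [].
  apply: val_inj; rewrite val_iter_ordS addnCA subnKC ?modnDr ?modn_small //.
  exact: ltnW.
have len i q b y : e y = @mk i q b -> clen g y = (i %% NV n)%N.
  by move=> ey; rewrite /clen (porb _ _ _ _ ey) card_imset ?card_ord //; apply: mki.
have color i q b y : e y = @mk i q b -> val (ccol g y) = (i %/ NV n)%N.
  move=> ey; have jp : (0 < i %% NV n)%N by apply: leq_ltn_trans (ltn_ord b).
  (* Only the padding index has quotient [r], and its length 0 is excluded by the point [b]. *)
  have ti : (i %/ NV n < r.-1.+1)%N.
    rewrite prednK // ltn_divLR //; have := ltn_ord i; rewrite /NX ltnS leq_eqVlt.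
    by case/predU1P => // ei; move: jp; rewrite ei modnMl.
  suff -> : ccol g y = inord (i %/ NV n) by rewrite /= inordK.
  rewrite /ccol (porb _ _ _ _ ey) big_imset /=; last by move=> c c' _ _; apply: mki.
  rewrite (bigD1 (Ordinal jp)) //= big1 ?addr0; first by rewrite ffunE dK.
  by move=> c; rewrite -val_eqE /= ffunE dK /= => /negPf->.
exists g; apply: ctype_of_card => // i; first by move=> /eqP i0; apply/eqP; apply: (implyP (m0 i)).
rewrite -mulnA [(_ * m i)%N]mulnC.
have -> : (m i * (i %% NV n))%N = #|[set d (Tagged TT v : T) | v : TT i]|.
  rewrite card_imset ?card_prod ?card_ord //.
  by move=> v v' /(can_inj dK)/eqP; rewrite eq_Tagged => /eqP.
rewrite -[X in (X * _)%N](prednK r0) -[X in (X * _)%N]card_ord -cardsT mulnC -cardsX.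
apply: eq_card => -[y c]; rewrite !inE ty_eq //= andbT.
case ey : (e y) => [i' [q b]]; rewrite (color i' q b) // (len i' q b) //.
apply/andP/imsetP => [[/eqP e1 /eqP e2]|[v _ ev]].
  have ii : i' = i by apply: val_inj; rewrite /= (divn_eq i' (NV n)) e1 e2 -divn_eq.
  by rewrite -ii; exists (q, b) => //; rewrite -[y]eK ey.
have : tag (e y) = i by rewrite ev dK.
by rewrite ey /= => ->.
Qed.
End Realize.

(** * The univariate generating function *)

Section Univariate.
Variables (r n : nat).
Hypothesis r0 : (0 < r)%N.

(* The specialisation [x_{t,j} |-> X^j]; the variables with [j = 0] and the padding
   variable do not occur in [sqrt_gf_multi] and are sent to [0]. *)
Definition spec (i : 'I_(NX r n)) : {poly rat} :=
  if (i %% NV n == 0)%N then 0 else 'X^(i %% NV n).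

(** A monomial becomes a power of ['X] with its weighted degree, or 0 if it involves an index with
    [j = 0]. *)
Lemma mmap1_spec (m : 'X_{1..NX r n}) : (mmap1 spec m)`_n = (weighted m)%:R.
Proof.
rewrite /mmap1 /weighted; case: (boolP [forall _, _]) => [/forallP m0|] /=.
  rewrite (eq_bigr (fun i : 'I_(NX r n) => 'X^((i %% NV n) * m i))); last first.
    move=> i _; rewrite /spec; have := m0 i; case: eqP => [-> /= /eqP->|_ _].
      by rewrite expr0 muln0.
    by rewrite exprM.
  rewrite -(big_morph (fun k => 'X^k : {poly rat}) (exprD _) (expr0 _)).
  by rewrite coefXn eq_sym.
rewrite negb_forall => /existsP[i]; rewrite negb_imply => /andP[i0 mi].
rewrite (bigD1 i) //= /spec i0 expr0n (negPf mi) mul0r coef0 //.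
Qed.

Definition specialize : {mpoly rat[NX r n]} -> {poly rat} := mmap (@polyC rat) spec.

HB.instance Definition _ := GRing.RMorphism.on specialize.

Lemma specializeZ c p : specialize (c *: p) = c *: specialize p.
Proof. by rewrite /specialize mmapZ mul_polyC. Qed.

Lemma specialize_trunc a N y :
  specialize (trunc_eval a N y) = trunc_eval a N (specialize y).
Proof.
rewrite /trunc_eval rmorph_sum /=; apply: eq_bigr => i _.
by rewrite specializeZ rmorphXn.
Qed.

Lemma specialize_xv t j : (t < r)%N -> (0 < j <= 2 * n)%N ->
  specialize (xv r n t j) = 'X^j.
Proof.
move=> tr /andP[j0 jn]; rewrite /specialize /xv mmapX mmap1U /spec inordK.
  by have [//|_ ->] := @divmod_NV n t j; rewrite (gtn_eqF j0).
by rewrite /NX /NV; nia.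
Qed.

(** Source of the exponents [r / 2] for even [r]. *)
Lemma card_odd_ord q : #|[pred t : 'I_(q.*2) | odd t]| = q /\
  #|[pred t : 'I_(q.*2) | ~~ odd t]| = q.
Proof.
have h : (\sum_(t < q.*2) odd t = q)%N.
  elim: q => [|q IH]; first by rewrite big_ord0.
  by rewrite doubleS !big_ord_recr /= IH odd_double; lia.
have c1 : #|[pred t : 'I_(q.*2) | odd t]| = q.
  by rewrite -[RHS]h -sum1_card big_mkcond; apply: eq_bigr => t _; rewrite inE; case: odd.
have := cardC [pred t : 'I_(q.*2) | odd t]; rewrite c1 card_ord -addnn => e.
by split=> //; apply: (@addnI q).
Qed.

Lemma specialize_multi : specialize (sqrt_gf_multi r n) = sqrt_gf_uni r n.
Proof.
rewrite /sqrt_gf_multi /sqrt_gf_uni; case: ifPn => odr; rewrite rmorph_prod /=.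
  apply: eq_big_nat => k kn; rewrite rmorph_prod /=.
  rewrite (eq_bigr (fun=> trunc_eval Dser n ((2 * k * r)%:R *: 'X^(4 * k)) *
       trunc_eval (Rser (r * (2 * k - 1))%:R) n 'X^(2 * k - 1))); last first.
    move=> t _; rewrite rmorphM /= !specialize_trunc specializeZ rmorphXn /=.
    rewrite !specialize_xv //; try lia; rewrite -exprM.
    by rewrite (_ : 2 * k * 2 = 4 * k)%N //; lia.
  by rewrite prodr_const card_ord exprMn.
have [q rq] : exists q, r = q.*2 by exists r./2; lia.
apply: eq_big_nat => k kn; rewrite !rmorphM !rmorph_prod /=.
have [c1 c2] := card_odd_ord q; rewrite -rq in c1 c2.
rewrite (_ : r./2 = q); last by rewrite rq doubleK.
congr (_ * _ * _).
- rewrite -[X in _ = _ ^+ X](card_ord r) -prodr_const; apply: eq_bigr => t _.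
  rewrite specialize_trunc specializeZ rmorphXn /= specialize_xv //; last by lia.
  by rewrite -exprM (_ : 2 * k * 2 = 4 * k)%N //; lia.
- rewrite -[in RHS]c1 -prodr_const; apply: eq_bigr => t _.
  rewrite specialize_trunc specializeZ rmorphXn /= specialize_xv //; last by lia.
  by rewrite -exprM (_ : (2 * k - 1) * 2 = 4 * k - 2)%N //; lia.
- rewrite -[in RHS]c2 -prodr_const; apply: eq_bigr => t _.
  by rewrite specialize_trunc specializeZ /= specialize_xv //; lia.
Qed.

Lemma coef_specialize p :
  (specialize p)`_n = \sum_(m <- msupp p | weighted m) p@_m.
Proof.
rewrite /specialize /mmap coef_sum [RHS]big_mkcond; apply: eq_bigr => m _.
by rewrite coefCM mmap1_spec; case: ifP => _; rewrite ?mulr1 ?mulr0.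
Qed.

(** The cycle type of the representative matches classes with weighted monomials: injective by
    [conj_of_ctype], surjective by [ctype_monom_exists]. *)
Lemma sqrt_gf_uni_coef :
  (\sum_(C in gclasses r n) nsqrt (crepr C))%:R = (sqrt_gf_uni r n)`_n.
Proof.
set p := sqrt_gf_multi r n; rewrite -specialize_multi coef_specialize -/p natr_sum.
under eq_bigr do rewrite sqrt_gf_multi_coef //.
pose mon C : 'X_{1..NX r n} := ctype_monom (crepr C).
have mon_inj : {in gclasses r n &, injective mon}.
  move=> C D CC DD e; rewrite -(creprP CC) -(creprP DD).
  by have [q ->] := conj_of_ctype r0 e; rewrite conj_class_conj.
have mon_surj m : weighted m -> exists2 C, C \in gclasses r n & mon C = m.
  case/(ctype_monom_exists r0) => g <-; exists (conj_class g); first exact: imset_f.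
  rewrite /mon /crepr; case: pickP => [h|/(_ g)]; last by rewrite conj_class_refl.
  by case/imsetP => q _ ->; rewrite ctype_monom_conj.
rewrite -big_enum /= -(big_map mon xpredT (fun m => p@_m)) -[RHS]big_filter.
(* Classes whose monomial is outside the support of [p] contribute 0; the others match the weighted
   part of the support. *)
rewrite [LHS](bigID (mem (msupp p))) /= [X in _ + X]big1 ?addr0; last first.
  by move=> m; apply: memN_msupp_eq0.
rewrite -[LHS]big_filter; apply: perm_big; apply: uniq_perm.
- rewrite filter_uniq // map_inj_in_uniq ?enum_uniq // => C D.
  by rewrite !mem_enum; apply: mon_inj.
- by rewrite filter_uniq // msupp_uniq.
move=> m; rewrite !mem_filter andbC; congr (_ && _).
apply/mapP/idP => [[C _ ->]|/mon_surj[C CC <-]]; first exact: weighted_ctype.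
by exists C; rewrite ?mem_enum.
Qed.
End Univariate.

Theorem theorem6p6 (r : nat) (hr : (0 < r)%N) :
  (forall (n : nat) (g : Grn r n),
      (nsqrt g)%:R = (sqrt_gf_multi r n)@_(ctype_monom g)) /\
  (forall n : nat,
      (\sum_(C in gclasses r n) nsqrt (crepr C))%:R = (sqrt_gf_uni r n)`_n).
Proof.
by split=> n *; [apply: sqrt_gf_multi_coef | apply: sqrt_gf_uni_coef].
Qed.
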